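(* Let $d\ge 1$ and let $p(\sigma,G)\propto p_G(G)\,\mathbf{1}_{G\models\sigma}$ be an order-modular distribution over pairs $(\sigma,G)$ of orders and directed graphs on $\{1,\dots,d\}$, with $p_G(G)=\prod_{i=1}^d p_{G_i}(G_i)$. Let $S_1,S_2$ be any disjoint subsets of $\{1,\dots,d\}$ and let $(S_{21},S_{22})$ be a partition of $S_2$. Then, conditional on the event that $\sigma_{S_2}$ is the concatenation $(\sigma_{S_{21}},\sigma_{S_{22}})$ of an ordering $\sigma_{S_{21}}$ of $S_{21}$ followed by an ordering $\sigma_{S_{22}}$ of $S_{22}$, the distribution proportional to $\tilde p_{S_1,S_2}$ factorizes as $$\tilde p_{S_1,S_2}\big(\sigma_{S_2},G_{S_2}\,\big|\,\sigma_{S_2}=(\sigma_{S_{21}},\sigma_{S_{22}})\big)\;\propto\;\tilde p_{S_1,S_{21}}(\sigma_{S_{21}},G_{S_{21}})\;\tilde p_{S_1\cup S_{21},\,S_{22}}(\sigma_{S_{22}},G_{S_{22}}),$$ where $\propto$ means equality up to a multiplicative constant not depending on $(\sigma_{S_{21}},\sigma_{S_{22}},G_{S_{21}},G_{S_{22}})$.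
   Context: An order $\sigma$ is a permutation (linear ordering) of $\{1,\dots,d\}$. For $S\subseteq\{1,\dots,d\}$, $\sigma_S$ denotes a linear ordering of the elements of $S$, and for $i\in S$, $\sigma_S^{<i}$ denotes the set of elements of $S$ preceding $i$ in $\sigma_S$ (with $\sigma^{<i}$ for $S=\{1,\dots,d\}$). A directed graph $G$ on $\{1,\dots,d\}$ is identified with the tuple of parent sets $(G_1,\dots,G_d)$, $G_i\subseteq\{1,\dots,d\}$ being the set of parents of $i$; $G_S=(G_i)_{i\in S}$. We write $G\models\sigma$ if $G_i\subseteq\sigma^{<i}$ for all $i$. A distribution $p$ on pairs $(\sigma,G)$ is order-modular if $p(\sigma,G)\propto\prod_{i=1}^d p_{G_i}(G_i)\,\mathbf{1}_{G_i\subseteq\sigma^{<i}}$ for nonnegative functions $p_{G_i}$ on subsets of $\{1,\dots,d\}$ (one for each $i$). For disjoint $S_1,S_2\subseteq\{1,\dots,d\}$ define the unnormalized distribution over $(\sigma_{S_2},G_{S_2})$ $$\tilde p_{S_1,S_2}(\sigma_{S_2},G_{S_2})=\prod_{i\in S_2}p_{G_i}(G_i)\,\mathbf{1}_{G_i\subseteq S_1\cup\sigma_{S_2}^{<i}}.$$ The conditional distribution given an event is the restriction of $\tilde p_{S_1,S_2}$ to the event, renormalized (the event is assumed to have positive mass so that this is defined). *)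

(* Defs.v *)
From HB Require Import structures.
From mathcomp Require Import all_boot all_order all_algebra.
Set Implicit Arguments.
Unset Strict Implicit.
Unset Printing Implicit Defensive.
Import Order.TTheory GRing.Theory Num.Theory.
Local Open Scope ring_scope.

Definition distribution (R : realFieldType) (T : finType) (p : T -> R) : Prop :=
  (forall x, 0 <= p x) /\ \sum_x p x = 1.

Definition proportional (R : realFieldType) (T : Type) (f g : T -> R) : Prop :=
  exists2 c : R, 0 < c & forall x, f x = c * g x.

Definition mass (R : realFieldType) (T : finType) (q : T -> R) (E : pred T) : R :=
  \sum_(x | E x) q x.

Definition conditional (R : realFieldType) (T : finType) (q : T -> R)
    (E : pred T) (x : T) : R :=
  if E x then q x / mass q E else 0.

(* The linear orderings of S: the sequences listing each element of S once. *)
Definition ordering (d : nat) (S : {set 'I_d}) : finType :=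
  seq_sub (permutations (enum S)).

Definition oseq (d : nat) (S : {set 'I_d}) (s : ordering S) : seq 'I_d := ssval s.

(* sigma_S^{<i}; only meaningful for i \in S. *)
Definition before (d : nat) (S : {set 'I_d}) (s : ordering S) (i : 'I_d) :
    {set 'I_d} :=
  [set j in oseq s | (index j (oseq s) < index i (oseq s))%N].

(* G_S, the parent sets of the nodes of S; the parents range over all nodes. *)
Definition parents (d : nat) (S : {set 'I_d}) : finType :=
  {ffun {i : 'I_d | i \in S} -> {set 'I_d}}.

Definition restrict (d : nat) (S T : {set 'I_d}) (sTS : T \subset S)
    (G : parents S) : parents T :=
  [ffun i => G (exist _ (val i) (subsetP sTS _ (valP i)))].

Definition digraph (d : nat) : finType := {ffun 'I_d -> {set 'I_d}}.

Definition models (d : nat) (G : digraph d) (s : ordering [set: 'I_d]) : bool :=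
  [forall i, G i \subset before s i].

Definition order_modular (R : realFieldType) (d : nat)
    (pG : 'I_d -> {set 'I_d} -> R)
    (p : ordering [set: 'I_d] * digraph d -> R) : Prop :=
  [/\ forall i A, 0 <= pG i A,
      distribution p
    & proportional p (fun x => (\prod_i pG i (x.2 i)) * (models x.2 x.1)%:R)].

Definition ptilde (R : realFieldType) (d : nat) (pG : 'I_d -> {set 'I_d} -> R)
    (S1 S2 : {set 'I_d}) (x : ordering S2 * parents S2) : R :=
  \prod_(i : {i : 'I_d | i \in S2})
    (pG (val i) (x.2 i) * (x.2 i \subset S1 :|: before x.1 (val i))%:R).

(* An ordered partition into two blocks; empty blocks are allowed. *)
Definition partition2 (d : nat) (S A B : {set 'I_d}) : Prop :=
  A :|: B = S /\ [disjoint A & B].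

Lemma partition2_subl (d : nat) (S A B : {set 'I_d}) :
  partition2 S A B -> A \subset S.
Proof. by case=> <- _; apply: subsetUl. Qed.

Lemma partition2_subr (d : nat) (S A B : {set 'I_d}) :
  partition2 S A B -> B \subset S.
Proof. by case=> <- _; apply: subsetUr. Qed.

Lemma ord_cat_subproof (d : nat) (S A B : {set 'I_d}) (hS : partition2 S A B)
    (s : ordering A) (t : ordering B) :
  oseq s ++ oseq t \in permutations (enum S).
Proof.
case: hS => defS dAB; rewrite mem_permutations.
have := ssvalP s; rewrite mem_permutations -/(oseq s) => ps.
have := ssvalP t; rewrite mem_permutations -/(oseq t) => pt.
apply: (perm_trans (perm_cat ps pt)); apply: uniq_perm.
- rewrite cat_uniq !enum_uniq andbT /=; apply/hasPn => i /=.
  rewrite !mem_enum => iB; apply/negP => iA.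
  by move/pred0P: dAB => /(_ i) /=; rewrite iA iB.
- exact: enum_uniq.
by move=> i; rewrite mem_cat !mem_enum -defS inE.
Qed.

Definition ord_cat (d : nat) (S A B : {set 'I_d}) (hS : partition2 S A B)
    (s : ordering A) (t : ordering B) : ordering S :=
  SeqSub (ord_cat_subproof hS s t).

Definition concat_event (d : nat) (S A B : {set 'I_d}) :
    pred (ordering S * parents S) :=
  fun x => [exists s : ordering A, exists t : ordering B,
              oseq x.1 == oseq s ++ oseq t].
Arguments concat_event {d} S A B _.

(* Main.v *)
Require Import Defs.
From HB Require Import structures.
From mathcomp Require Import all_boot all_order all_algebra.
Set Implicit Arguments.
Unset Strict Implicit.
Unset Printing Implicit Defensive.
Import Order.TTheory GRing.Theory Num.Theory.
Local Open Scope ring_scope.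

(** In a concatenated order, a node of the first block is preceded only by nodes of its own block,
    while a node of the second block is preceded by the entire first block and by its predecessors
    within its own ([before_ord_cat_l], [before_ord_cat_r]). Since [ptilde] is a product of one
    factor per node, it splits exactly over the two blocks, the first block joining [S1] in the
    second factor ([ptilde_ord_cat]). Conditioning on the event merely divides by its mass. *)

Lemma mem_oseq (d : nat) (S : {set 'I_d}) (s : ordering S) : oseq s =i S.
Proof.
move=> i; have := ssvalP s; rewrite mem_permutations => /perm_mem/(_ i).
by rewrite mem_enum.
Qed.

Section OrdCat.
Variables (d : nat) (S A B : {set 'I_d}) (hS : partition2 S A B).
Variables (s : ordering A) (t : ordering B).

Lemma before_ord_cat_l (i : 'I_d) :
  i \in A -> before (ord_cat hS s t) i = before s i.
Proof.
move=> iA; apply/setP => j; rewrite !inE /= mem_cat !index_cat.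
rewrite !mem_oseq iA.
case: (boolP (j \in A)) => //= jA; apply/andP => -[_].
(* Outside [A], the index of [j] is at least the length of [oseq s], which bounds that of [i]. *)
by rewrite ltnNge (leq_trans (index_size _ _)) // leq_addr.
Qed.

Lemma before_ord_cat_r (i : 'I_d) :
  i \in B -> before (ord_cat hS s t) i = A :|: before t i.
Proof.
have [_ dAB] := hS => iB.
have iA : i \notin A by rewrite (disjointFl dAB iB).
apply/setP => j; rewrite !inE /= mem_cat !index_cat !mem_oseq (negPf iA).
(* Outside [A], both indices are shifted by the length of [oseq s], and the shift cancels; inside
   [A], the index of [j] is below that length. *)
case: (boolP (j \in A)) => /= jA; last by rewrite ltn_add2l.
by rewrite (leq_trans _ (leq_addr _ _)) // index_mem mem_oseq.
Qed.

End OrdCat.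

(* Extending G_S by empty parent sets outside S turns products over the
   subtype of elements of S into products over i \in S, which can be split. *)
Definition extend (d : nat) (S : {set 'I_d}) (G : parents S) (i : 'I_d) :
    {set 'I_d} :=
  if insub i is Some u then G u else set0.

Lemma extend_val (d : nat) (S : {set 'I_d}) (G : parents S) u :
  extend G (val u) = G u.
Proof. by rewrite /extend valK. Qed.

Lemma extend_restrict (d : nat) (S T : {set 'I_d}) (sTS : T \subset S)
    (G : parents S) (i : 'I_d) :
  i \in T -> extend (restrict sTS G) i = extend G i.
Proof.
move=> iT; rewrite -[i]/(val (exist (fun i => i \in T) i iT)) extend_val ffunE.
by rewrite -extend_val.
Qed.

Lemma ptildeE (R : realFieldType) (d : nat) (pG : 'I_d -> {set 'I_d} -> R)
    (S1 S2 : {set 'I_d}) (s : ordering S2) (G : parents S2) :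
  ptilde pG S1 (s, G) =
  \prod_(i in S2)
    (pG i (extend G i) * (extend G i \subset S1 :|: before s i)%:R).
Proof.
rewrite [RHS](reindex_omap (val : {i : 'I_d | i \in S2} -> _) insub) /=; last first.
  by move=> i iS; rewrite insubT.
apply: eq_big => [u|u _]; first by rewrite valK (valP u) eqxx.
by rewrite extend_val.
Qed.

Lemma ptilde_ord_cat (R : realFieldType) (d : nat)
    (pG : 'I_d -> {set 'I_d} -> R) (S1 S A B : {set 'I_d})
    (hS : partition2 S A B) (s : ordering A) (t : ordering B) (G : parents S) :
  ptilde pG S1 (ord_cat hS s t, G) =
  ptilde pG S1 (s, restrict (partition2_subl hS) G)
  * ptilde pG (S1 :|: A) (t, restrict (partition2_subr hS) G).
Proof.
have [defS dAB] := hS; rewrite !ptildeE.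
rewrite (eq_bigl [in [predU A & B]]) => [|i]; last by rewrite -defS !inE.
rewrite bigU //=; congr (_ * _); apply: eq_bigr => i iX.
  by rewrite extend_restrict // before_ord_cat_l.
(* Reassociating the union moves [A] from the predecessors of [i] to the context [S1]. *)
by rewrite extend_restrict // before_ord_cat_r // setUA.
Qed.

Theorem proposition1 (R : realFieldType) (d : nat) (d_ge1 : (1 <= d)%N)
    (pG : 'I_d -> {set 'I_d} -> R)
    (p : ordering [set: 'I_d] * digraph d -> R)
    (p_om : order_modular pG p)
    (S1 S2 S21 S22 : {set 'I_d})
    (dS12 : [disjoint S1 & S2])
    (hS2 : partition2 S2 S21 S22)
    (mass_gt0 : 0 < mass (ptilde pG S1 (S2 := S2)) (concat_event S2 S21 S22)) :
  proportional
    (fun y : ordering S21 * ordering S22 * parents S2 =>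
       let: (s21, s22, G) := y in
       conditional (ptilde pG S1 (S2 := S2)) (concat_event S2 S21 S22)
         (ord_cat hS2 s21 s22, G))
    (fun y : ordering S21 * ordering S22 * parents S2 =>
       let: (s21, s22, G) := y in
       ptilde pG S1 (s21, restrict (partition2_subl hS2) G)
       * ptilde pG (S1 :|: S21) (s22, restrict (partition2_subr hS2) G)).
Proof.
(* The normalizing constant depends on neither the orders nor the graph. *)
exists (mass (ptilde pG S1 (S2 := S2)) (concat_event S2 S21 S22))^-1.
  by rewrite invr_gt0.
move=> [[s t] G]; rewrite /conditional ifT.
  by rewrite ptilde_ord_cat mulrC.
by apply/existsP; exists s; apply/existsP; exists t.
Qed.
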